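(* $$-\frac{1}{\zeta(4)+4\zeta(2)-8}=\mathrm{CF}\left[n^4+(n+1)^4+2\{n^2+(n+1)^2\},\,-n^8\right].$$
   Context: For sequences $(a_n)_{n\ge0}$, $(b_n)_{n\ge1}$, $\mathrm{CF}[a_n,b_n]$ denotes the continued fraction $a_0+\cfrac{b_1}{a_1+\cfrac{b_2}{a_2+\ddots}}$, whose value is $\lim_{n\to\infty}A_n/B_n$, where $A_0=1$, $A_1=a_0$, $B_0=0$, $B_1=1$, and $A_{n+1}=a_nA_n+b_nA_{n-1}$, $B_{n+1}=a_nB_n+b_nB_{n-1}$ for $n\ge1$. $\zeta$ is the Riemann zeta function. *)

(* Defs.v *)
From Stdlib Require Import Reals.
From Coquelicot Require Import Coquelicot.

Open Scope R_scope.

(* Dirichlet series [sum_{k >= 1} 1 / k ^ s]. It is the Riemann zeta function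
   on the half-line [s > 1] only; [Series] is total, so the value is
   meaningless where the series diverges. *)
Definition zeta (s : R) : R :=
  Series (fun k : nat => / Rpower (INR (S k)) s).

(* The numerators [A_n] and denominators [B_n] are shifted by one from the most
   common convention: [A_1 / B_1 = a 0], while [A_0 = 1] and [B_0 = 0].
   The partial numerators are [b 1, b 2, ...]; [b 0] is never used. *)
Fixpoint cf_num (a b : nat -> R) (n : nat) : R :=
  match n with
  | O => 1
  | S m =>
      match m with
      | O => a O
      | S p => a m * cf_num a b m + b m * cf_num a b p
      end
  end.

Fixpoint cf_den (a b : nat -> R) (n : nat) : R :=
  match n with
  | O => 0
  | S m =>
      match m with
      | O => 1
      | S p => a m * cf_den a b m + b m * cf_den a b p
      end
  end.

(* [CF[a_n, b_n]] converges to [l]. Division by zero is total, hence the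
   explicit requirement that the convergents are eventually defined. *)
Definition is_CF (a b : nat -> R) (l : R) : Prop :=
  eventually (fun n => cf_den a b n <> 0) /\
  is_lim_seq (fun n => cf_num a b n / cf_den a b n) l.

(* Main.v *)
Require Import Defs.
From Stdlib Require Import Reals.
From Stdlib Require Import Factorial Lra Lia.
From Coquelicot Require Import Coquelicot.
Open Scope R_scope.

(** The numerators have the closed form [A_n = (2n+1) n!^4], because
    [(n+1)^4 - n^4 = (2n+1)(n^2 + (n+1)^2)]. The Casoratian of the recurrence
    then gives [B_n / A_n = sum_{k=1}^n 1 / (k^4 (2k-1)(2k+1))], and
    [1 / (k^4 (4k^2-1)) = 16 / (4k^2-1) - 1 / k^4 - 4 / k^2], where the first
    term telescopes to [8]. *)

(** Matches the recurrences of [cf_num] and [cf_den], which reach back two indices. *)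
Lemma two_step_ind (P : nat -> Prop) :
  P O -> P (S O) -> (forall n, P n -> P (S n) -> P (S (S n))) ->
  forall n, P n.
Proof.
  intros P0 P1 PS n.
  enough (P n /\ P (S n)) by tauto.
  induction n as [|n [IHn IHSn]]; auto.
Qed.

Lemma INR_fact_S (n : nat) : INR (fact (S n)) = (INR n + 1) * INR (fact n).
Proof. now rewrite fact_simpl, mult_INR, S_INR. Qed.

Lemma sum_Sn_R (u : nat -> R) (n : nat) :
  sum_n u (S n) = sum_n u n + u (S n).
Proof. exact (sum_Sn u n). Qed.

Section ClosedForms.

Let a (n : nat) : R :=
  INR n ^ 4 + (INR n + 1) ^ 4 + 2 * (INR n ^ 2 + (INR n + 1) ^ 2).
Let b (n : nat) : R := - INR n ^ 8.

Lemma cf_num_closed (n : nat) :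
  cf_num a b n = (2 * INR n + 1) * INR (fact n) ^ 4.
Proof.
  induction n as [| |n IHn IHSn] using two_step_ind.
  - simpl; ring.
  - unfold a; simpl; ring.
  - change (a (S n) * cf_num a b (S n) + b (S n) * cf_num a b n
            = (2 * INR (S (S n)) + 1) * INR (fact (S (S n))) ^ 4).
    rewrite IHn, IHSn; unfold a, b.
    rewrite !INR_fact_S, !S_INR; ring.
Qed.

(** The increment [B_(k+1) / A_(k+1) - B_k / A_k]: the Casoratian [k!^8] divided by [A_k A_(k+1)].
    The index is shifted, so [k] here is [k - 1] in the sum above. *)
Definition ratio_term (k : nat) : R :=
  / ((INR k + 1) ^ 4 * (2 * INR k + 1) * (2 * INR k + 3)).

Lemma cf_den_closed (n : nat) :
  cf_den a b (S n) = cf_num a b (S n) * sum_n ratio_term n.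
Proof.
  induction n as [| |n IHn IHSn] using two_step_ind.
  - rewrite sum_O; unfold ratio_term, a; simpl; field.
  - rewrite sum_Sn_R, sum_O; unfold ratio_term, a, b; simpl; field.
  - change (a (S (S n)) * cf_den a b (S (S n)) + b (S (S n)) * cf_den a b (S n)
            = cf_num a b (S (S (S n))) * sum_n ratio_term (S (S n))).
    rewrite IHn, IHSn, !cf_num_closed, !sum_Sn_R.
    unfold ratio_term, a, b.
    rewrite !INR_fact_S, !S_INR.
    (* With the partial sum opaque, both sides are affine in [s]; its coefficients agree because the
       numerators satisfy the same recurrence. *)
    set (s := sum_n _ n); pose proof (pos_INR n); field; lra.
Qed.

End ClosedForms.

Lemma cf_num_closed_form_pos (n : nat) : 0 < (2 * INR n + 1) * INR (fact n) ^ 4.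
Proof.
  pose proof (pos_INR n).
  apply Rmult_lt_0_compat; [lra|].
  apply pow_lt, INR_fact_lt_0.
Qed.

(** Each term is [8/(2k+1) - 8/(2k+3)], so the partial sum up to [n] is [8 - 8/(2n+3)]. *)
Lemma is_series_telescope :
  is_series (fun k => 16 / ((2 * INR k + 1) * (2 * INR k + 3))) 8.
Proof.
  apply (is_lim_seq_ext (fun n => 8 - 8 * / (2 * INR n + 3)) (sum_n _) 8).
  - intros n; induction n as [|n IHn].
    + rewrite sum_O; simpl; field.
    + rewrite sum_Sn_R, <- IHn, S_INR; pose proof (pos_INR n).
      field; lra.
  - replace (Finite 8) with (Finite (8 - 8 * 0)) by (f_equal; ring).
    apply is_lim_seq_minus'; [apply is_lim_seq_const|].
    apply (is_lim_seq_scal_l _ 8 0).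
    apply (is_lim_seq_inv _ p_infty); [|discriminate].
    apply is_lim_seq_le_p_loc with INR; [|apply is_lim_seq_INR].
    exists O; intros n _; pose proof (pos_INR n); lra.
Qed.

(** Comparison with the telescoping series: [(2k+1)(2k+3) = 4(k+1)^2 - 1 <= 16(k+1)^2]. *)
Lemma ex_series_inv_sqr : ex_series (fun k => / (INR k + 1) ^ 2).
Proof.
  apply (ex_series_le (V := R_CompleteNormedModule) _ (fun k => 16 / ((2 * INR k + 1) * (2 * INR k + 3)))).
  - intros k; pose proof (pos_INR k).
    change (Rabs (/ (INR k + 1) ^ 2)
            <= 16 / ((2 * INR k + 1) * (2 * INR k + 3))).
    rewrite Rabs_pos_eq by (apply Rlt_le, Rinv_0_lt_compat; nra).
    replace (16 / ((2 * INR k + 1) * (2 * INR k + 3)))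
      with (/ (((2 * INR k + 1) * (2 * INR k + 3)) / 16)) by (field; lra).
    apply Rinv_le_contravar; nra.
  - exists 8; apply is_series_telescope.
Qed.

Lemma ex_series_inv_pow (m : nat) :
  (2 <= m)%nat -> ex_series (fun k => / (INR k + 1) ^ m).
Proof.
  intros Hm.
  apply (ex_series_le (V := R_CompleteNormedModule) _ (fun k => / (INR k + 1) ^ 2)).
  - intros k; pose proof (pos_INR k).
    change (Rabs (/ (INR k + 1) ^ m) <= / (INR k + 1) ^ 2).
    rewrite Rabs_pos_eq by (apply Rlt_le, Rinv_0_lt_compat, pow_lt; lra).
    apply Rinv_le_contravar; [apply pow_lt; lra|].
    apply Rle_pow; [lra|exact Hm].
  - apply ex_series_inv_sqr.
Qed.

(** Since [Series] is total, convergence has to be supplied before [zeta] can serve as a genuine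
    sum; [Rpower] becomes an ordinary power at integer exponents. *)
Lemma is_series_zeta (m : nat) :
  (2 <= m)%nat -> is_series (fun k => / (INR k + 1) ^ m) (zeta (INR m)).
Proof.
  intros Hm; unfold zeta.
  rewrite (Series_ext _ (fun k => / (INR k + 1) ^ m)).
  - now apply Series_correct, ex_series_inv_pow.
  - intros k; rewrite Rpower_pow by (apply lt_0_INR; lia).
    now rewrite S_INR.
Qed.

Lemma is_series_ratio_term : is_series ratio_term (8 - zeta 4 - 4 * zeta 2).
Proof.
  replace 4 with (INR 4) at 1 by (simpl; ring).
  replace 2 with (INR 2) by (simpl; ring).
  apply is_series_ext with
    (fun k => 16 / ((2 * INR k + 1) * (2 * INR k + 3))
              - / (INR k + 1) ^ 4 - 4 * / (INR k + 1) ^ 2).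
  - intros k; pose proof (pos_INR k); unfold ratio_term.
    (* The equality is stated in the carrier of a normed module; [field] needs it in [R]. *)
    match goal with |- ?x = ?y => change (@eq R x y) end.
    field; lra.
  - apply (is_series_minus (V := R_NormedModule)).
    + apply (is_series_minus (V := R_NormedModule)); [apply is_series_telescope|].
      apply is_series_zeta; lia.
    + apply (is_series_scal (V := R_NormedModule) 4), is_series_zeta; lia.
Qed.

Lemma ratio_term_pos (k : nat) : 0 < ratio_term k.
Proof.
  pose proof (pos_INR k); unfold ratio_term.
  apply Rinv_0_lt_compat.
  repeat apply Rmult_lt_0_compat; lra.
Qed.

(** The first term is [1/3] and the others are positive. This keeps the denominators [B_(n+1)] and
    the limit of the sums away from zero. *)
Lemma sum_ratio_term_ge (n : nat) : / 3 <= sum_n ratio_term n.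
Proof.
  induction n as [|n IHn].
  - rewrite sum_O; unfold ratio_term; simpl; lra.
  - rewrite sum_Sn_R; pose proof (ratio_term_pos (S n)); lra.
Qed.

Theorem theorem3p3 :
  is_CF
    (fun n : nat => INR n ^ 4 + (INR n + 1) ^ 4
                    + 2 * (INR n ^ 2 + (INR n + 1) ^ 2))
    (fun n : nat => - INR n ^ 8)
    (- (1 / (zeta 4 + 4 * zeta 2 - 8))).
Proof.
  assert (Hl : / 3 <= 8 - zeta 4 - 4 * zeta 2).
  { apply (is_lim_seq_le (fun _ => / 3) (sum_n ratio_term) (/ 3)
             (8 - zeta 4 - 4 * zeta 2)).
    - apply sum_ratio_term_ge.
    - apply is_lim_seq_const.
    - apply is_series_ratio_term. }
  split.
  (* Index 0 is excluded because [B_0 = 0]. *)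
  - exists 1%nat; intros [|n] Hn; [lia|].
    rewrite cf_den_closed, cf_num_closed.
    pose proof (cf_num_closed_form_pos (S n)); pose proof (sum_ratio_term_ge n).
    apply Rmult_integral_contrapositive_currified; lra.
  - apply is_lim_seq_incr_1.
    (* The factor [A_(n+1)] cancels from the convergent, leaving the reciprocal of a partial sum. *)
    apply is_lim_seq_ext with (fun n => / sum_n ratio_term n).
    + intros n; rewrite cf_den_closed, cf_num_closed.
      pose proof (cf_num_closed_form_pos (S n)); pose proof (sum_ratio_term_ge n).
      field; split; [lra|]; split; [apply INR_fact_neq_0|].
      pose proof (pos_INR (S n)); lra.
    + replace (- (1 / (zeta 4 + 4 * zeta 2 - 8)))
        with (/ (8 - zeta 4 - 4 * zeta 2)) by (field; lra).
      apply (is_lim_seq_inv _ (8 - zeta 4 - 4 * zeta 2)).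
      * apply is_series_ratio_term.
      * intros [=]; lra.
Qed.
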